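(* Consider a finite two-player zero-sum extensive-form game with imperfect information and perfect recall, played repeatedly for hands $t=1,2,\dots,T$ between players hero and opp, and let $\varepsilon_{\max}\ge 0$. Suppose: (a) at every hand $t$ the runtime maintains a deployed pair $(\sigma_H^{(t)},B_t)$, possibly random and dependent on the history of previous hands, where $\sigma_H^{(t)}$ is a complete behavioural strategy of hero, $B_t$ is its certificate relative to the exact game value, $$B_t=\max_{\sigma_{\mathrm{opp}}}u_{\mathrm{opp}}(\sigma_H^{(t)},\sigma_{\mathrm{opp}})-v^*_{\mathrm{opp}},$$ the maximum being over all behavioural strategies of opp in the original game, and hero plays exactly $\sigma_H^{(t)}$ at hand $t$, without modification; (b) a pair is admitted for deployment only if its certificate is at most $\varepsilon_{\max}$, so that $B_t\le\varepsilon_{\max}$ at every hand $t$. Then for every hand $t$ and every opponent strategy $\sigma_{\mathrm{opp}}^{(t)}$ used at hand $t$, including one selected adaptively with knowledge of $\sigma_H^{(t)}$ and of the agent's state, the conditional expected value of hand $t$ satisfies $$u_{\mathrm{hero}}(\sigma_H^{(t)},\sigma_{\mathrm{opp}}^{(t)})\ \ge\ v^*_{\mathrm{hero}}-B_t\ \ge\ v^*_{\mathrm{hero}}-\varepsilon_{\max}.$$ Consequently, for every horizon $T\ge1$, the expected mean per-hand gain satisfies $$\mathbb{E}\left[\frac1T\sum_{t=1}^{T}\bigl(u_{\mathrm{hero}}(\sigma_H^{(t)},\sigma_{\mathrm{opp}}^{(t)})-v^*_{\mathrm{hero}}\bigr)\right]\ \ge\ -\varepsilon_{\max}.$$ (These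 bounds concern expected values; realized winnings also contain the game's per-hand variance.)
   Context: A behavioural strategy of a player assigns to each of that player's information sets a probability distribution over the legal actions there. For a profile $(\sigma_{\mathrm{hero}},\sigma_{\mathrm{opp}})$, $u_i(\sigma_{\mathrm{hero}},\sigma_{\mathrm{opp}})$ denotes player $i$'s expected payoff in one hand; the game is zero-sum, so $u_{\mathrm{hero}}=-u_{\mathrm{opp}}$. $v^*_i$ is the value of the one-hand game to player $i$ (its expected payoff in a Nash equilibrium), so $v^*_{\mathrm{hero}}=-v^*_{\mathrm{opp}}$. Hero may change strategy between hands. The opponent's strategy at hand $t$ may depend on the history, on $\sigma_H^{(t)}$, and on the agent's internal state. The conditional expected value of hand $t$ is the expected payoff of that hand given the strategies in force, i.e. $u_{\mathrm{hero}}(\sigma_H^{(t)},\sigma_{\mathrm{opp}}^{(t)})$; the per-hand gain is this quantity minus $v^*_{\mathrm{hero}}$. *)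

(* Defs.v *)
From mathcomp Require Import all_boot all_order all_algebra.
From mathcomp Require Import all_classical all_reals all_analysis.

Set Implicit Arguments.
Unset Strict Implicit.
Unset Printing Implicit Defensive.

Import Order.TTheory GRing.Theory Num.Theory.
Local Open Scope classical_set_scope.
Local Open Scope ring_scope.

Inductive player := hero | opponent.

Definition same_player (i j : player) : bool :=
  match i, j with hero, hero | opponent, opponent => true | _, _ => false end.

Definition is_dist (R : realType) (A : finType) (p : A -> R) : Prop :=
  (forall a, 0 <= p a) /\ \sum_a p a = 1.

(* Finitely branching, well-founded trees.  The actions available at a decision
   node are indexed by its information set, so that they are the same at all
   the nodes of one information set. *)
Inductive gtree (R : realType) (I : player -> finType)
    (A : forall i, I i -> finType) : Type :=
| Terminal (payoff : player -> R)
| Chance (n : nat) (p : 'I_n -> R) (next : 'I_n -> gtree R A)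
| Decision (i : player) (h : I i) (next : A i h -> gtree R A).

Arguments Terminal {R I A}.
Arguments Chance {R I A n}.
Arguments Decision {R I A i}.

Record move (I : player -> finType) (A : forall i, I i -> finType) := Move {
  mover : player;
  move_infoset : I mover;
  move_action : A mover move_infoset }.

Arguments Move {I A mover}.

(* [reaches t m t']: some path from the root of [t] leads to a node whose
   subtree is [t'], and [m] lists the moves of both players on that path, from
   the root down; the outcomes of chance nodes are not recorded. *)
Inductive reaches (R : realType) (I : player -> finType)
    (A : forall i, I i -> finType) :
    gtree R A -> seq (move A) -> gtree R A -> Prop :=
| reaches_root t : reaches t [::] t
| reaches_chance n (p : 'I_n -> R) (next : 'I_n -> gtree R A) k m t :
    reaches (next k) m t -> reaches (Chance p next) m t
| reaches_decision i (h : I i) (next : A i h -> gtree R A) a m t :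
    reaches (next a) m t -> reaches (Decision h next) (Move h a :: m) t.

Definition own_moves (I : player -> finType) (A : forall i, I i -> finType)
    (i : player) (m : seq (move A)) : seq (move A) :=
  [seq x <- m | same_player (mover x) i].

(* At any two nodes of an information set, its owner has passed through the
   same sequence of own information sets and taken the same actions there. *)
Definition perfect_recall (R : realType) (I : player -> finType)
    (A : forall i, I i -> finType) (root : gtree R A) : Prop :=
  forall i (h : I i) m1 m2 (next1 next2 : A i h -> gtree R A),
    reaches root m1 (Decision h next1) ->
    reaches root m2 (Decision h next2) ->
    own_moves i m1 = own_moves i m2.

Definition zero_sum (R : realType) (I : player -> finType)
    (A : forall i, I i -> finType) (root : gtree R A) : Prop :=
  forall m payoff, reaches root m (Terminal payoff) ->
    payoff hero = - payoff opponent.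

Definition chance_dist (R : realType) (I : player -> finType)
    (A : forall i, I i -> finType) (root : gtree R A) : Prop :=
  forall m n (p : 'I_n -> R) next, reaches root m (Chance p next) -> is_dist p.

Record game (R : realType) := Game {
  infoset : player -> finType;
  action : forall i, infoset i -> finType;
  root : gtree R action;
  action_nonempty : forall i (h : infoset i), (0 < #|action h|)%N;
  root_chance_dist : chance_dist root;
  root_zero_sum : zero_sum root;
  root_perfect_recall : perfect_recall root }.

Arguments infoset {R}.
Arguments action {R} g {i}.

Record strategy (R : realType) (G : game R) (i : player) := Strategy {
  prob :> forall h : infoset G i, action G h -> R;
  prob_dist : forall h, is_dist (@prob h) }.

Arguments prob {R G i} s h _.

Fixpoint tree_payoff (R : realType) (I : player -> finType)
    (A : forall i, I i -> finType) (s : forall i (h : I i), A i h -> R)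
    (i : player) (t : gtree R A) : R :=
  match t with
  | Terminal payoff => payoff i
  | Chance n p next => \sum_(k < n) p k * tree_payoff s i (next k)
  | Decision j h next => \sum_(a : A j h) s j h a * tree_payoff s i (next a)
  end.

Definition profile (R : realType) (G : game R)
    (sh : strategy G hero) (so : strategy G opponent) (i : player) : strategy G i :=
  match i with hero => sh | opponent => so end.

Definition u (R : realType) (G : game R) (i : player)
    (sh : strategy G hero) (so : strategy G opponent) : R :=
  tree_payoff (fun j => prob (profile sh so j)) i (root G).

Definition nash (R : realType) (G : game R)
    (sh : strategy G hero) (so : strategy G opponent) : Prop :=
  (forall sh', u hero sh' so <= u hero sh so) /\
  (forall so', u opponent sh so' <= u opponent sh so).

(* Equilibria exist by the minimax theorem together with Kuhn's theorem, and by
   the zero-sum property they all give player i the same payoff; the default 0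
   of [xget] is therefore never used. *)
Definition value (R : realType) (G : game R) (i : player) : R :=
  xget 0 [set v | exists (sh : strategy G hero) (so : strategy G opponent),
    nash sh so /\ u i sh so = v].

(* The payoffs are continuous on a nonempty compact set of strategies of the opponent,
   so this supremum is a maximum. *)
Definition best_response_value (R : realType) (G : game R)
    (sh : strategy G hero) : R :=
  sup (range (fun so : strategy G opponent => u opponent sh so)).

Definition certificate (R : realType) (G : game R)
    (sh : strategy G hero) : R :=
  best_response_value sh - value G opponent.

Definition random_strategy (R : realType) (d : measure_display)
    (Omega : measurableType d) (G : game R) (i : player)
    (s : Omega -> strategy G i) : Prop :=
  forall (h : infoset G i) (a : action G h),
    measurable_fun setT (fun w => s w h a).

(* Main.v *)
Require Import Defs.
From mathcomp Require Import all_boot all_order all_algebra.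
From mathcomp Require Import all_classical all_reals all_analysis.
From mathcomp Require Import measurable_realfun.
Import Order.TTheory GRing.Theory Num.Theory.
Local Open Scope classical_set_scope.
Local Open Scope ring_scope.

(* The zero-sum property gives [value G hero = - value G opponent], so that
   [value G hero - B t] is minus the best-response value against hero's
   strategy: hero's worst expected payoff. The bound on the mean is the
   integral of the pointwise bound; the mean is integrable because expected
   payoffs are bounded and measurable in the behavioural probabilities. *)

Lemma is_dist_itv {R : realType} {A : finType} {p : A -> R} (a : A) :
  is_dist p -> 0 <= p a <= 1.
Proof.
move=> [p0 p1]; rewrite p0 -p1 (bigD1 a) //= lerDl.
by apply: sumr_ge0 => b _; exact: p0.
Qed.

(** The hypothesis passes to subtrees, since a path inside a subtree extends to a path from the root
    of [t]. *)
Lemma tree_payoff_zero_sum {R : realType} {I : player -> finType}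
    {A : forall i, I i -> finType} (s : forall i (h : I i), A i h -> R)
    (t : gtree R A) :
  zero_sum t -> tree_payoff s hero t = - tree_payoff s opponent t.
Proof.
elim: t => [payoff|n p next IH|i h next IH] zt /=.
- exact: (zt [::] payoff (reaches_root _)).
- rewrite -sumrN; apply: eq_bigr => k _; rewrite IH ?mulrN// => m payoff r.
  by apply: (zt m); apply: reaches_chance r.
- rewrite -sumrN; apply: eq_bigr => a _; rewrite IH ?mulrN// => m payoff r.
  by apply: (zt (Move h a :: m)); exact: reaches_decision r.
Qed.

(** Each action weight is at most 1, so the bounds of the subtrees can be added; chance weights
    enter through [|p k|]. Uniformity in [s] serves both the supremum over opponents and
    integrability. *)
Lemma tree_payoff_bounded {R : realType} {I : player -> finType}
    {A : forall i, I i -> finType} (i : player) (t : gtree R A) :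
  exists M : R, forall s : forall j (h : I j), A j h -> R,
    (forall j h a, 0 <= s j h a <= 1) -> `|tree_payoff s i t| <= M.
Proof.
elim: t => [payoff|n p next IH|j h next IH] /=.
- by exists `|payoff i|.
- have [M HM] := choice IH.
  exists (\sum_(k < n) `|p k| * M k) => s s01.
  apply: (le_trans (ler_norm_sum _ _ _)); apply: ler_sum => k _.
  by rewrite normrM ler_wpM2l// HM.
- have [M HM] := choice IH.
  exists (\sum_(a : A j h) M a) => s s01.
  apply: (le_trans (ler_norm_sum _ _ _)); apply: ler_sum => a _.
  have /andP[s0 s1] := s01 j h a.
  by rewrite normrM ger0_norm// (le_trans _ (HM a s s01))// ler_piMl.
Qed.

Lemma measurable_tree_payoff {R : realType} {d : measure_display}
    {Omega : measurableType d} {I : player -> finType}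
    {A : forall i, I i -> finType}
    (s : Omega -> forall j (h : I j), A j h -> R) (i : player)
    (t : gtree R A) :
  (forall j h a, measurable_fun setT (fun w => s w j h a)) ->
  measurable_fun setT (fun w => tree_payoff (s w) i t).
Proof.
move=> ms; elim: t => [payoff|n p next IH|j h next IH] /=.
- exact: measurable_cst.
- by apply: measurable_sum => k; exact: measurable_funM.
- by apply: measurable_sum => a; exact: measurable_funM.
Qed.

Lemma u_zero_sum {R : realType} {G : game R} (sh : strategy G hero)
    (so : strategy G opponent) :
  u hero sh so = - u opponent sh so.
Proof. exact/tree_payoff_zero_sum/root_zero_sum. Qed.

Lemma u_bounded {R : realType} (G : game R) (i : player) :
  exists M : R, forall (sh : strategy G hero) (so : strategy G opponent),
    `|u i sh so| <= M.
Proof.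
have [M HM] := tree_payoff_bounded i (Defs.root G).
by exists M => sh so; apply: HM => j h a; exact/is_dist_itv/prob_dist.
Qed.

Lemma measurable_u {R : realType} {d : measure_display}
    {Omega : measurableType d} {G : game R} (i : player)
    (sh : Omega -> strategy G hero) (so : Omega -> strategy G opponent) :
  random_strategy sh -> random_strategy so ->
  measurable_fun setT (fun w => u i (sh w) (so w)).
Proof.
by move=> msh mso; apply: measurable_tree_payoff => -[] h a; [exact: msh|exact: mso].
Qed.

(** Interchange of equilibria: [o1] minimises hero's payoff against [s1], and [s2] maximises it
    against [o2], so passing from [(s1, o1)] through [(s1, o2)] to [(s2, o2)] never lowers hero's
    payoff. Symmetry gives equality. *)
Lemma nash_payoff_unique {R : realType} {G : game R}
    (sh sh' : strategy G hero) (so so' : strategy G opponent) :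
  nash sh so -> nash sh' so' -> u hero sh so = u hero sh' so'.
Proof.
have le_nash (s1 s2 : strategy G hero) (o1 o2 : strategy G opponent) :
    nash s1 o1 -> nash s2 o2 -> u hero s1 o1 <= u hero s2 o2.
  move=> [_ min1] [max2 _]; apply: le_trans (max2 s1).
  by rewrite !u_zero_sum lerN2.
by move=> n n'; apply/eqP; rewrite eq_le !le_nash.
Qed.

(* Without an equilibrium both values are the default 0 of [xget]. *)
Lemma value_zero_sum {R : realType} (G : game R) :
  value G hero = - value G opponent.
Proof.
rewrite /value; case: xgetP => [x _ [sh [so [n <-]]]|noh];
  case: xgetP => [y _ [sh' [so' [n' <-]]]|noo].
- by rewrite -u_zero_sum; exact: nash_payoff_unique.
- by case: (noo (u opponent sh so)); exists sh, so.
- by case: (noh (u hero sh' so')); exists sh', so'.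
- by rewrite oppr0.
Qed.

(** A real [sup] dominates its set only if that set is bounded above; [u_bounded] supplies the
    bound. *)
Lemma u_opponent_le_best_response {R : realType} {G : game R}
    (sh : strategy G hero) (so : strategy G opponent) :
  u opponent sh so <= best_response_value sh.
Proof.
apply: ub_le_sup; last by exists so.
have [M HM] := u_bounded G opponent; exists M.
move=> _ [so' _ <-].
exact: le_trans (ler_norm _) (HM _ _).
Qed.

Lemma certificate_le_u {R : realType} {G : game R} (sh : strategy G hero)
    (so : strategy G opponent) :
  value G hero - certificate sh <= u hero sh so.
Proof.
rewrite /certificate value_zero_sum u_zero_sum opprB addKr lerN2.
exact: u_opponent_le_best_response.
Qed.

Theorem proposition1 (R : realType) (d : measure_display)
    (Omega : measurableType d) (P : probability Omega R)
    (G : game R) (eps_max : R) (heps : 0 <= eps_max) (T : nat)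
    (sigma_H : 'I_T -> Omega -> strategy G hero) (B : 'I_T -> Omega -> R)
    (played : 'I_T -> Omega -> strategy G hero)
    (sigma_H_random : forall t, random_strategy (sigma_H t))
    (B_certificate : forall t w, B t w = certificate (sigma_H t w))
    (hero_plays : forall t w, played t w = sigma_H t w)
    (admitted : forall t w, B t w <= eps_max) :
  (forall (t : 'I_T) (w : Omega) (sigma_opp : strategy G opponent),
     value G hero - B t w <= u hero (played t w) sigma_opp /\
     value G hero - eps_max <= value G hero - B t w) /\
  ((1 <= T)%N ->
   forall sigma_opp : 'I_T -> Omega -> strategy G opponent,
     (forall t, random_strategy (sigma_opp t)) ->
     ((- eps_max)%:E <=
      'E_P[(fun w => T%:R^-1 *
              \sum_(t < T)
                (u hero (played t w) (sigma_opp t w) - value G hero))%R])%E).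
Proof.
have key t w so : value G hero - B t w <= u hero (played t w) so.
  by rewrite hero_plays B_certificate certificate_le_u.
split=> [t w so|T1 sigma_opp mopp].
  by split; [exact: key|rewrite lerD2l lerN2].
set f : Omega -> R := fun w => _.
have f_ge w : - eps_max <= f w.
  (* Clear the factor [T%:R^-1] and write [T] copies of the constant as a sum over ['I_T], so that
     the comparison is made hand by hand. *)
  rewrite /f ler_pdivlMl ?ltr0n// mulr_natl -[X in _ *+ X]card_ord -sumr_const.
  apply: ler_sum => t _; rewrite lerBrDl.
  by apply: le_trans (key _ _ _); rewrite lerD2l lerN2.
have mf : measurable_fun setT f.
  apply: measurable_funM => //; apply: measurable_sum => t.
  apply: measurable_funB => //; apply: measurable_u => // h a.
  by under eq_fun do rewrite hero_plays; exact: sigma_H_random.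
have [M HM] := u_bounded G hero.
have f_le w : f w <= M + `|value G hero|.
  rewrite /f ler_pdivrMl ?ltr0n// mulr_natl -[X in _ *+ X]card_ord -sumr_const.
  apply: ler_sum => t _; apply: le_trans (ler_norm _) _.
  by apply: le_trans (ler_normB _ _) _; rewrite lerD2r.
have PT : (P setT < +oo)%E by rewrite probability_setT ltry.
have intf : P.-integrable setT (EFin \o f).
  apply: measurable_bounded_integrable => //.
  (* The sum of the two one-sided bounds dominates each of them, as both are nonnegative. *)
  exists (eps_max + (M + `|value G hero|)); split; first exact: num_real.
  move=> x Mx w _; apply: le_trans (ltW Mx).
  have M0 : 0 <= M + `|value G hero|.
    (* [M] bounds an absolute value, hence is nonnegative once some profile is at hand; the first
       hand provides one. *)
    pose t := Ordinal T1.
    by rewrite addr_ge0// (le_trans _ (HM (played t w) (sigma_opp t w))).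
  rewrite ler_norml (le_trans (f_le w)) ?lerDr// andbT.
  by apply: le_trans (f_ge w); rewrite lerN2 lerDl.
(* Since [P] has total mass 1, the constant [- eps_max] is its own integral, and monotonicity of the
   integral applies. *)
rewrite unlock -[leLHS]mule1 -(probability_setT P) -integral_cst//.
apply: le_integral => //; first exact: finite_measure_integrable_cst.
by move=> w _; rewrite lee_fin.
Qed.
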